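(* Consider the following two rewriting rules on finite simple directed graphs. Sequential flow: if $b$ is the only successor of $a$ and $a$ is the only predecessor of $b$, merge $a$ and $b$. Parallel flow: if $a\neq b$ have the same set of predecessors and the same set of successors, merge $a$ and $b$. This rewriting system is confluent: for every finite simple digraph $G$, any two graphs obtained from $G$ by finite sequences of rule applications can be further reduced by rule applications to a common graph. In particular, applying the rules in any order until no rule is applicable yields a unique reduced graph.
   Context: Merging two vertices $a,b$ of $G=(V,E)$ replaces them by a single new vertex $v_{ab}$ (which records the merged set of original vertices), whose predecessors are the predecessors of $a$ or $b$ other than $a,b$, and whose successors are the successors of $a$ or $b$ other than $a,b$; all other arcs are unchanged and no loops are created. Graphs resulting from different sequences are compared by identifying vertices corresponding to the same sets of original vertices. *)

(* Defs.v *)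
From HB Require Import structures.
From mathcomp Require Import all_boot.
From Stdlib Require Import Relation_Operators.

Set Implicit Arguments.
Unset Strict Implicit.
Unset Printing Implicit Defensive.

(* A simple digraph obtained by merging vertices of a digraph on V.  Each
   vertex is represented by the set of original vertices merged into it, so
   the vertex set is a partition of V, and Leibniz equality of such graphs is
   equality up to identifying vertices that record the same original
   vertices.  Arcs are ordered pairs (tail, head); opposite arcs are allowed. *)
Record mdigraph (V : finType) := MDigraph {
  verts : {set {set V}};
  arcs : {set {set V} * {set V}};
  verts_partition : partition verts [set: V];
  arcs_verts : arcs \subset setX verts verts;
  arcs_noloop : [forall x, (x, x) \notin arcs] }.

Lemma mdigraph_eq (V : finType) (G H : mdigraph V) :
  verts G = verts H -> arcs G = arcs H -> G = H.
Proof.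
case: G H => [v a p s l] [v' a' p' s' l'] /= ev ea.
move: p s l p' s' l'; rewrite ev ea => p s l p' s' l'.
by congr MDigraph; apply: bool_irrelevance.
Qed.

Section InitialDigraph.
Variables (V : finType) (e : rel V).

Definition init_verts : {set {set V}} := [set [set x] | x in V].
Definition init_arcs : {set {set V} * {set V}} :=
  [set ([set p.1], [set p.2]) | p : V * V & e p.1 p.2].

Lemma init_partition : partition init_verts [set: V].
Proof.
apply/and3P; split.
- apply/eqP/setP => x; rewrite inE; apply/bigcupP.
  by exists [set x]; rewrite ?imset_f ?set11.
- apply/trivIsetP => _ _ /imsetP[x _ ->] /imsetP[y _ ->] nxy.
  by rewrite disjoints1 inE; apply: contra nxy => /eqP ->.
- by apply/imsetP => -[x _ /setP/(_ x)]; rewrite !inE eqxx.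
Qed.

Lemma init_arcs_verts : init_arcs \subset setX init_verts init_verts.
Proof. by apply/subsetP => _ /imsetP[p _ ->]; rewrite inE /= !imset_f. Qed.

Lemma init_noloop : irreflexive e -> [forall x, (x, x) \notin init_arcs].
Proof.
move=> irr; apply/forallP => x; apply/imsetP => -[[y z]].
rewrite inE /= => eyz [-> /set1_inj yz].
by rewrite yz irr in eyz.
Qed.

End InitialDigraph.

Definition digraph_of (V : finType) (e : rel V) (irr : irreflexive e) :
    mdigraph V :=
  MDigraph (init_partition V) (init_arcs_verts e) (init_noloop irr).

Definition preds (V : finType) (G : mdigraph V) (a : {set V}) : {set {set V}} :=
  [set x | (x, a) \in arcs G].
Definition succs (V : finType) (G : mdigraph V) (a : {set V}) : {set {set V}} :=
  [set y | (a, y) \in arcs G].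

Section Merge.
Variables (V : finType) (G : mdigraph V) (a b : {set V}).

Definition merge_verts : {set {set V}} := (a :|: b) |: verts G :\: [set a; b].
Definition merge_arcs : {set {set V} * {set V}} :=
  [set p in arcs G | (p.1 \notin [set a; b]) && (p.2 \notin [set a; b])]
  :|: [set (x, a :|: b) | x in (preds G a :|: preds G b) :\: [set a; b]]
  :|: [set (a :|: b, y) | y in (succs G a :|: succs G b) :\: [set a; b]].

Hypotheses (ha : a \in verts G) (hb : b \in verts G).

Lemma vertsP (x y : {set V}) (z : V) :
  x \in verts G -> y \in verts G -> z \in x -> z \in y -> x = y.
Proof.
move=> hx hy zx zy; have /and3P[_ tG _] := verts_partition G.
by rewrite -(def_pblock tG hx zx) (def_pblock tG hy zy).
Qed.

Lemma verts_neq0 (x : {set V}) : x \in verts G -> exists z, z \in x.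
Proof.
move=> hx; have /and3P[_ _ n0] := verts_partition G.
by apply/set0Pn; apply: contraNneq n0 => <-.
Qed.

Lemma arc_verts (x y : {set V}) :
  (x, y) \in arcs G -> (x \in verts G) /\ (y \in verts G).
Proof. by move=> /(subsetP (arcs_verts G)); rewrite inE /= => /andP[]. Qed.

Lemma merged_fresh (x : {set V}) :
  x \in verts G -> x \notin [set a; b] -> x != a :|: b.
Proof.
move=> hx; apply: contraNneq => ex; have [z za] := verts_neq0 ha.
by rewrite (vertsP hx ha (z := z)) ?set21 // ex inE za.
Qed.

Lemma merge_partition : partition merge_verts [set: V].
Proof.
have dis x : x \in verts G :\: [set a; b] -> [disjoint a :|: b & x].
  rewrite inE => /andP[nx hx]; apply/pred0P => z /=; apply/negbTE/negP.
  rewrite inE => /andP[/orP[] zz zx]; move: nx.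
    by rewrite (vertsP hx ha zx zz) set21.
  by rewrite (vertsP hx hb zx zz) set22.
have /and3P[/eqP cG /trivIsetP tG n0] := verts_partition G.
apply/and3P; split.
- apply/eqP/setP => z; rewrite inE; apply/bigcupP.
  have: z \in cover (verts G) by rewrite cG inE.
  case/bigcupP => x hx zx; case: (boolP (x \in [set a; b])) => xab.
    exists (a :|: b); first by rewrite setU11.
    by move: xab zx; rewrite !inE => /orP[] /eqP -> ->; rewrite ?orbT.
  by exists x => //; rewrite in_setU1 in_setD xab hx orbT.
- apply/trivIsetP => x y /setU1P[->|hx] /setU1P[->|hy] nxy.
  + by rewrite eqxx in nxy.
  + exact: dis.
  + by rewrite disjoint_sym dis.
  + by apply: tG nxy; [move: hx | move: hy]; rewrite inE => /andP[].
- apply/negP => /setU1P[e0|]; last by rewrite inE (negbTE n0) andbF.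
  have [z za] := verts_neq0 ha.
  by move/setP/(_ z): e0; rewrite !inE za.
Qed.

Lemma merge_arcs_verts : merge_arcs \subset setX merge_verts merge_verts.
Proof.
have nb x : (x \in (preds G a :|: preds G b) :\: [set a; b]) ||
            (x \in (succs G a :|: succs G b) :\: [set a; b]) ->
    x \in merge_verts.
  rewrite in_setU1 !in_setD -andb_orr => /andP[-> h]; apply/orP; right.
  by move: h; rewrite !in_setU !inE -orbA => /or4P[] /arc_verts[].
apply/subsetP => -[x y] /setUP[/setUP[|]|].
- rewrite in_set => /and3P[/= /arc_verts[hx hy] nx ny].
  by rewrite in_setX !in_setU1 !in_setD nx ny hx hy !orbT.
- by case/imsetP => z hz [-> ->]; rewrite in_setX setU11 nb ?hz.
- by case/imsetP => z hz [-> ->]; rewrite in_setX setU11 nb ?hz ?orbT.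
Qed.

Lemma merge_noloop : [forall x, (x, x) \notin merge_arcs].
Proof.
apply/forallP => x; apply/negP => /setUP[/setUP[|]|].
- by rewrite in_set (negbTE (forallP (arcs_noloop G) x)).
- case/imsetP => z /setDP[h nz] [-> ez].
  have hz : z \in verts G.
    by move: h; rewrite !inE => /orP[] /arc_verts[].
  by have := merged_fresh hz nz; rewrite -ez eqxx.
- case/imsetP => z /setDP[h nz] [-> ez].
  have hz : z \in verts G.
    by move: h; rewrite !inE => /orP[] /arc_verts[].
  by have := merged_fresh hz nz; rewrite -ez eqxx.
Qed.

Definition merge : mdigraph V :=
  MDigraph merge_partition merge_arcs_verts merge_noloop.

End Merge.

Inductive rule_step (V : finType) (G : mdigraph V) : mdigraph V -> Prop :=
| SequentialFlow (a b : {set V}) (ha : a \in verts G) (hb : b \in verts G) :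
    succs G a = [set b] -> preds G b = [set a] -> rule_step G (merge ha hb)
| ParallelFlow (a b : {set V}) (ha : a \in verts G) (hb : b \in verts G) :
    a != b -> preds G a = preds G b -> succs G a = succs G b ->
    rule_step G (merge ha hb).

Definition reduces_to (V : finType) : mdigraph V -> mdigraph V -> Prop :=
  clos_refl_trans (mdigraph V) (@rule_step V).

Definition reduced (V : finType) (G : mdigraph V) : Prop :=
  forall H : mdigraph V, ~ rule_step G H.

(* Main.v *)
(* Each step removes a vertex, so by Newman's lemma local confluence suffices.
   Two redexes on disjoint pairs do not disturb each other.  A sequential and
   a parallel redex never share a vertex, and two distinct overlapping redexes
   of the same kind are either a chain a -> b -> c or three twins, where the
   second merge remains possible after the first.  Iterated merging only
   depends on the resulting partition, which gives the equality of the two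
   final graphs. *)
Require Import Defs.
From HB Require Import structures.
From mathcomp Require Import all_boot.
From Stdlib Require Import Relation_Operators Operators_Properties.
From Stdlib Require Import Relations_2 Relations_3 Relations_3_facts.

Set Implicit Arguments.
Unset Strict Implicit.
Unset Printing Implicit Defensive.

(* [path.merge] from [all_boot] shadows the merge of vertices. *)
Local Notation merge := Defs.merge.

(** * Quotients of a digraph by a coarser partition *)

Section Contraction.
Variable V : finType.
Implicit Types G H K : mdigraph V.

(** [H] is the loop-free quotient of [G] by the partition [verts H]. Stating it by inclusion instead
    of through a map makes it independent of the merges that led to [H]. *)
Definition contracts G H : Prop :=
  (forall x, x \in verts G ->
     exists2 X : {set V}, X \in verts H & x \subset X) /\
  (forall X Y : {set V}, (X, Y) \in arcs H <->
     [/\ X \in verts H, Y \in verts H, X != Y &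
       exists x y : {set V}, [/\ x \subset X, y \subset Y & (x, y) \in arcs G]]).

Lemma verts_sub_eq G H x X Y : x \in verts G -> X \in verts H ->
  Y \in verts H -> x \subset X -> x \subset Y -> X = Y.
Proof.
move=> hx hX hY /subsetP xX /subsetP xY; have [z zx] := verts_neq0 hx.
exact: (vertsP hX hY (xX z zx) (xY z zx)).
Qed.

Lemma contracts_trans G H K : contracts G H -> contracts H K -> contracts G K.
Proof.
move=> [vGH aGH] [vHK aHK]; split=> [x /vGH[y /vHK[z hz yz] xy]|X Y].
  by exists z => //; apply: subset_trans yz.
split=> [/aHK[hX hY nXY [x' [y' [x'X y'Y]]]]|].
  case/aGH=> _ _ _ [x [y [xx' yy' xy]]]; split=> //; exists x, y; split=> //.
    exact: subset_trans x'X.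
  exact: subset_trans y'Y.
case=> hX hY nXY [x [y [xX yY xy]]]; have [hx hy] := arc_verts xy.
(* The vertex of [H] above [w] lies in some vertex of [K], which must be [W] because both contain
   [w]. *)
have lift w W : w \in verts G -> W \in verts K -> w \subset W ->
    exists w', [/\ w' \in verts H, w \subset w' & w' \subset W].
  move=> hw hW wW; have [w' hw' ww'] := vGH w hw; exists w'; split=> //.
  have [W' hW' w'W'] := vHK w' hw'.
  by rewrite (verts_sub_eq hw hW hW' wW (subset_trans ww' w'W')).
have [x' [hx' xx' x'X]] := lift x X hx hX xX.
have [y' [hy' yy' y'Y]] := lift y Y hy hY yY.
apply/aHK; split=> //; exists x', y'; split=> //; apply/aGH; split=> //.
  (* If the arc collapsed already in [H], then [X] and [Y] would share a vertex of [H]. *)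
  apply: contra nXY => /eqP exy; rewrite -exy in y'Y.
  by rewrite (verts_sub_eq hx' hX hY x'X y'Y).
by exists x, y.
Qed.

(** The partition determines the arcs of a quotient. This reduces every comparison of merge orders
    below to an equality of vertex sets. *)
Lemma contracts_verts_inj G H K :
  contracts G H -> contracts G K -> verts H = verts K -> H = K.
Proof.
move=> [_ aH] [_ aK] eHK; apply: mdigraph_eq => //.
apply/setP => -[X Y]; apply/idP/idP.
  by case/aH; rewrite eHK => *; apply/aK.
by case/aK; rewrite -eHK => *; apply/aH.
Qed.

Lemma arc_neq G x y : (x, y) \in arcs G -> x != y.
Proof. by apply: contraTneq => ->; apply: (forallP (arcs_noloop G)). Qed.

End Contraction.

(** * A single merge as a quotient map *)

Section MergeTheory.
Variables (V : finType) (G : mdigraph V) (a b : {set V}).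
Hypotheses (ha : a \in verts G) (hb : b \in verts G).
Implicit Types (x y c X Y : {set V}).

Definition merge_map x := if x \in [set a; b] then a :|: b else x.

Lemma merge_map_id x : x \notin [set a; b] -> merge_map x = x.
Proof. by rewrite /merge_map => /negbTE ->. Qed.

Lemma merge_map_ab x : x \in [set a; b] -> merge_map x = a :|: b.
Proof. by rewrite /merge_map => ->. Qed.

Lemma mem_merge_verts x : x \in verts (merge ha hb) =
  (x == a :|: b) || [&& x != a, x != b & x \in verts G].
Proof. by rewrite /= /merge_verts !inE negb_or andbA. Qed.

Lemma merge_map_verts x : x \in verts G -> merge_map x \in verts (merge ha hb).
Proof.
move=> hx; rewrite mem_merge_verts /merge_map.
case: ifPn => [_|]; first by rewrite eqxx.
by rewrite !inE negb_or => /andP[-> ->]; rewrite hx orbT.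
Qed.

Lemma merge_map_sub x : x \subset merge_map x.
Proof.
rewrite /merge_map; case: ifP => // /set2P[] ->; first exact: subsetUl.
exact: subsetUr.
Qed.

(** The merged vertex is never an untouched vertex of [G], so an untouched [c] has no preimage but
    itself. *)
Lemma merge_map_fresh x c : x \in verts G -> c \in verts G ->
  c \notin [set a; b] -> merge_map x = c -> x = c.
Proof.
rewrite /merge_map; case: ifP => // _ hx hc nc e.
by have := merged_fresh (b := b) ha hc nc; rewrite e eqxx.
Qed.

(** Replaces the three-part union in [merge_arcs] by a uniform image; [X != Y] discards exactly the
    arcs between [a] and [b]. *)
Lemma arcs_mergeP X Y :
  reflect (exists x y,
             [/\ (x, y) \in arcs G, X = merge_map x, Y = merge_map y & X != Y])
          ((X, Y) \in arcs (merge ha hb)).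
Proof.
apply: (iffP idP) => [h|[x [y [xy -> -> nXY]]]].
  have nXY := arc_neq h.
  move: h nXY => /setUP[/setUP[|]|].
  - rewrite inE => /and3P[/= xy nx ny] nXY.
    by exists X, Y; rewrite !merge_map_id.
  - case/imsetP => x /setDP[/setUP[]]; rewrite inE => xa nx [-> ->] nXY.
      by exists x, a; rewrite (merge_map_id nx) merge_map_ab ?set21.
    by exists x, b; rewrite (merge_map_id nx) merge_map_ab ?set22.
  - case/imsetP => x /setDP[/setUP[]]; rewrite inE => xa nx [-> ->] nXY.
      by exists a, x; rewrite (merge_map_id nx) merge_map_ab ?set21.
    by exists b, x; rewrite (merge_map_id nx) merge_map_ab ?set22.
move: nXY; rewrite /merge_map /= /merge_arcs.
case: ifPn => hx; case: ifPn => hy nXY; first by rewrite eqxx in nXY.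
- apply/setUP; right; apply/imsetP; exists y => //.
  by rewrite inE hy !inE; case/set2P: hx => <-; rewrite xy ?orbT.
- apply/setUP; left; apply/setUP; right; apply/imsetP; exists x => //.
  by rewrite inE hx !inE; case/set2P: hy => <-; rewrite xy ?orbT.
- by apply/setUP; left; apply/setUP; left; rewrite inE xy hx hy.
Qed.

(** [merge_map x] is the only vertex of the merge that contains [x], so images and inclusions
    describe the same arcs. *)
Lemma merge_contracts : contracts G (merge ha hb).
Proof.
split=> [x hx|X Y].
  by exists (merge_map x); rewrite ?merge_map_verts ?merge_map_sub.
split=> [h|[hX hY nXY [x [y [xX yY xy]]]]].
  have [hX hY] := arc_verts h.
  case/arcs_mergeP: h => x [y [xy eX eY nXY]]; split=> //.
  by exists x, y; rewrite eX eY !merge_map_sub.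
have [hx hy] := arc_verts xy.
apply/arcs_mergeP; exists x, y; split=> //.
  exact: (verts_sub_eq hx hX (merge_map_verts hx) xX (merge_map_sub x)).
exact: (verts_sub_eq hy hY (merge_map_verts hy) yY (merge_map_sub y)).
Qed.

(** Neighbourhoods of untouched vertices are transported by one fixed map, so equalities between
    them survive the merge. No arc at [c] is lost, since by [merge_map_fresh] none becomes a
    loop. *)
Lemma preds_merge c : c \in verts G -> c \notin [set a; b] ->
  preds (merge ha hb) c = merge_map @: preds G c.
Proof.
move=> hc nc; apply/setP => X; rewrite inE.
apply/arcs_mergeP/imsetP => [[x [y [xy -> ey _]]]|[x]].
  have [_ hy] := arc_verts xy.
  by exists x; rewrite // inE -(merge_map_fresh hy hc nc (esym ey)).
rewrite inE => xc ->; exists x, c; rewrite (merge_map_id nc); split=> //.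
have [hx _] := arc_verts xc.
by apply: contraNneq (arc_neq xc) => /(merge_map_fresh hx hc nc) ->.
Qed.

Lemma succs_merge c : c \in verts G -> c \notin [set a; b] ->
  succs (merge ha hb) c = merge_map @: succs G c.
Proof.
move=> hc nc; apply/setP => Y; rewrite inE.
apply/arcs_mergeP/imsetP => [[x [y [xy ex -> _]]]|[y]].
  have [hx _] := arc_verts xy.
  by exists y; rewrite // inE -(merge_map_fresh hx hc nc (esym ex)).
rewrite inE => cy ->; exists c, y; rewrite (merge_map_id nc); split=> //.
have [_ hy] := arc_verts cy; rewrite eq_sym.
by apply: contraNneq (arc_neq cy) => /(merge_map_fresh hy hc nc) ->.
Qed.

Lemma merge_map_eqU x : x \in verts G ->
  (merge_map x == a :|: b) = (x \in [set a; b]).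
Proof.
move=> hx; rewrite /merge_map; case: ifPn => [_|nx]; first exact: eqxx.
exact: negbTE (merged_fresh ha hx nx).
Qed.

Lemma preds_mergeU : preds (merge ha hb) (a :|: b) =
  (preds G a :|: preds G b) :\: [set a; b].
Proof.
apply/setP => X; rewrite inE.
apply/arcs_mergeP/setDP => [[x [y [xy eX eY nX]]]|[h nX]].
  have [hx hy] := arc_verts xy.
  move: nX; rewrite eX merge_map_eqU // => nx; rewrite merge_map_id //.
  split=> //; move/esym/eqP: eY; rewrite merge_map_eqU // => /set2P[] <-.
    by rewrite !inE xy.
  by rewrite !inE xy orbT.
have [y hy Xy] : exists2 y, y \in [set a; b] & (X, y) \in arcs G.
  by case/setUP: h; rewrite inE => h; [exists a | exists b];
    rewrite ?set21 ?set22.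
exists X, y; rewrite (merge_map_id nX) merge_map_ab //; split=> //.
by have [hX _] := arc_verts Xy; apply: (merged_fresh ha hX nX).
Qed.

Lemma succs_mergeU : succs (merge ha hb) (a :|: b) =
  (succs G a :|: succs G b) :\: [set a; b].
Proof.
apply/setP => Y; rewrite inE.
apply/arcs_mergeP/setDP => [[x [y [xy eX eY nY]]]|[h nY]].
  have [hx hy] := arc_verts xy.
  move: nY; rewrite eY eq_sym merge_map_eqU // => ny; rewrite merge_map_id //.
  split=> //; move/esym/eqP: eX; rewrite merge_map_eqU // => /set2P[] <-.
    by rewrite !inE xy.
  by rewrite !inE xy orbT.
have [x hx xY] : exists2 x, x \in [set a; b] & (x, Y) \in arcs G.
  by case/setUP: h; rewrite inE => h; [exists a | exists b];
    rewrite ?set21 ?set22.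
exists x, Y; rewrite (merge_map_id nY) merge_map_ab //; split=> //.
by have [_ hY] := arc_verts xY; rewrite eq_sym (merged_fresh ha hY nY).
Qed.

Lemma imset_merge_map_id (A : {set {set V}}) :
  a \notin A -> b \notin A -> merge_map @: A = A.
Proof.
move=> nA nB; rewrite -[RHS]imset_id; apply: eq_in_imset => x xA.
by apply: merge_map_id; apply: contraL xA => /set2P[] ->.
Qed.

(** Two vertices are removed and at most one is added. *)
Lemma card_merge_verts : a != b -> #|verts (merge ha hb)| < #|verts G|.
Proof.
move=> nab; rewrite /= /merge_verts.
have sub : [set a; b] \subset verts G by apply/subsetP=> x /set2P[] ->.
have := subset_leq_card sub; rewrite cards2 nab => le2.
apply: leq_ltn_trans (leq_card_setU _ _).1 _.
by rewrite cards1 cardsD (setIidPr sub) cards2 nab -ltn_subRL ltn_sub2l.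
Qed.

End MergeTheory.

Lemma merge_sym (V : finType) (G : mdigraph V) (a b : {set V})
    (ha : a \in verts G) (hb : b \in verts G) : merge ha hb = merge hb ha.
Proof.
apply: contracts_verts_inj (merge_contracts ha hb) (merge_contracts hb ha) _.
by apply/setP => x; rewrite !mem_merge_verts setUC andbCA.
Qed.

(** * Vertex sets after two merges *)

Section MergeTwice.
Variables (V : finType) (G : mdigraph V) (a b c d : {set V}).
Hypotheses (ha : a \in verts G) (hb : b \in verts G).

(** The intermediate vertex [a :|: b] is consumed by the second merge and is not an untouched vertex
    of [G], so it drops out and the formula becomes symmetric in [a], [b], [c]. *)
Lemma merge_overlap_verts (hab : a :|: b \in verts (merge ha hb))
    (hc : c \in verts (merge ha hb)) x :
  x \in verts (merge hab hc) =
  (x == a :|: b :|: c) || [&& x != a, x != b, x != c & x \in verts G].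
Proof.
rewrite !mem_merge_verts; congr (_ || _).
have [hx|] := boolP (x \in verts G); last first.
  by rewrite !andbF orbF; case: eqVneq; rewrite ?andbF.
have [->|na] := eqVneq x a.
  by case: eqVneq => [->|]; rewrite ?eqxx ?andbF //.
have [->|nb] := eqVneq x b; first by case: eqVneq; rewrite ?eqxx ?andbF.
have nx : x \notin [set a; b] by rewrite !inE negb_or na.
by rewrite (negbTE (merged_fresh ha hx nx)) andbT.
Qed.

(** Here [a :|: b] survives the second merge, as it differs from the untouched [c] and [d]. *)
Lemma merge_disjoint_verts (hc : c \in verts G) (hd : d \in verts G)
    (hc' : c \in verts (merge ha hb)) (hd' : d \in verts (merge ha hb)) x :
  c \notin [set a; b] -> d \notin [set a; b] ->
  x \in verts (merge hc' hd') = [|| x == c :|: d, x == a :|: b |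
    [&& x != a, x != b, x != c, x != d & x \in verts G]].
Proof.
move=> nc nd; rewrite !mem_merge_verts; congr (_ || _).
have [->|_] := eqVneq x (a :|: b).
  have cab := merged_fresh (b := b) ha hc nc.
  have dab := merged_fresh (b := b) ha hd nd.
  by rewrite eq_sym cab eq_sym dab.
by case: (x == a) (x == b) (x == c) (x == d) => [] [] [] [].
Qed.

End MergeTwice.

(** * Redexes and their persistence *)

Section Confluence.
Variable V : finType.
Implicit Types (G H K : mdigraph V) (a b c d : {set V}).

(** Boolean forms of the rule premises, so that redexes can be case-split and searched for. *)
Definition sequential G a b := (succs G a == [set b]) && (preds G b == [set a]).
Definition parallel G a b :=
  [&& a != b, preds G a == preds G b & succs G a == succs G b].
Definition flow G a b := sequential G a b || parallel G a b.

Lemma preds_notin G a : a \notin preds G a.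
Proof. by rewrite inE; apply: (forallP (arcs_noloop G)). Qed.

Lemma succs_notin G a : a \notin succs G a.
Proof. by rewrite inE; apply: (forallP (arcs_noloop G)). Qed.

Lemma rule_stepP G H : rule_step G H <->
  exists a b (ha : a \in verts G) (hb : b \in verts G),
    flow G a b /\ H = merge ha hb.
Proof.
split=> [[a b ha hb e1 e2|a b ha hb nab e1 e2]|[a [b [ha [hb [f ->]]]]]].
- exists a, b, ha, hb; split=> //.
  by rewrite /flow /sequential e1 e2 !eqxx.
- exists a, b, ha, hb; split=> //.
  by rewrite /flow /parallel nab e1 e2 !eqxx orbT.
case/orP: f => [/andP[/eqP e1 /eqP e2]|/and3P[nab /eqP e1 /eqP e2]].
  exact: SequentialFlow.
exact: ParallelFlow.
Qed.

Lemma flow_step G a b (ha : a \in verts G) (hb : b \in verts G) :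
  flow G a b -> rule_step G (merge ha hb).
Proof. by move=> f; apply/rule_stepP; exists a, b, ha, hb. Qed.

(** For a sequential pair, [a = b] would give a loop at [a]. *)
Lemma flow_neq G a b : flow G a b -> a != b.
Proof.
case/orP => [/andP[/eqP e _]|/and3P[]//].
by apply/eqP => eab; have := succs_notin G a; rewrite e eab set11.
Qed.

Lemma parallel_sym G a b : parallel G a b = parallel G b a.
Proof. by rewrite /parallel eq_sym [preds _ _ == _]eq_sym [succs _ _ == _]eq_sym. Qed.

(** All neighbourhoods involved become images under [merge_map], which fixes [c] and [d]. *)
Lemma flow_merge G a b c d (ha : a \in verts G) (hb : b \in verts G) :
  c \in verts G -> d \in verts G ->
  c \notin [set a; b] -> d \notin [set a; b] ->
  flow G c d -> flow (merge ha hb) c d.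
Proof.
move=> hc hd nc nd; rewrite /flow /sequential /parallel.
rewrite !preds_merge // !succs_merge //.
case/orP => [/andP[/eqP -> /eqP ->]|/and3P[-> /eqP -> /eqP ->]].
  by rewrite !imset_set1 !merge_map_id // !eqxx.
by rewrite !eqxx orbT.
Qed.

(** * Joining two diverging steps *)

Definition joinable H1 H2 :=
  exists K, reduces_to H1 K /\ reduces_to H2 K.

Lemma joinable_sym H1 H2 : joinable H1 H2 -> joinable H2 H1.
Proof. by case=> K []; exists K. Qed.

Lemma joinable_refl H : joinable H H.
Proof. by exists H; split; apply: rt_refl. Qed.

Lemma join_step H1 H2 K1 K2 :
  rule_step H1 K1 -> rule_step H2 K2 -> K1 = K2 -> joinable H1 H2.
Proof. by move=> s1 s2 eK; exists K1; rewrite {2}eK; split; apply: rt_step. Qed.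

Lemma mem_merge_other G a b c (ha : a \in verts G) (hb : b \in verts G) :
  c \in verts G -> c \notin [set a; b] -> c \in verts (merge ha hb).
Proof. by rewrite mem_merge_verts !inE negb_or => -> /andP[-> ->]; rewrite orbT. Qed.

Lemma mem_merge_new G a b (ha : a \in verts G) (hb : b \in verts G) :
  a :|: b \in verts (merge ha hb).
Proof. by rewrite mem_merge_verts eqxx. Qed.

Lemma join_disjoint G a b c d (ha : a \in verts G) (hb : b \in verts G)
    (hc : c \in verts G) (hd : d \in verts G) :
  flow G a b -> flow G c d -> c \notin [set a; b] -> d \notin [set a; b] ->
  joinable (merge ha hb) (merge hc hd).
Proof.
move=> fab fcd nc nd.
have [na nb] : a \notin [set c; d] /\ b \notin [set c; d].
  by move: nc nd; rewrite !inE !negb_or ![c == _]eq_sym ![d == _]eq_sym;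
    do 4!case: eqP.
have hc' := mem_merge_other ha hb hc nc; have hd' := mem_merge_other ha hb hd nd.
have ha' := mem_merge_other hc hd ha na; have hb' := mem_merge_other hc hd hb nb.
apply: join_step (flow_step hc' hd' _) (flow_step ha' hb' _) _;
  try exact: flow_merge.
apply: (contracts_verts_inj (G := G)).
- exact: contracts_trans (merge_contracts ha hb) (merge_contracts _ _).
- exact: contracts_trans (merge_contracts hc hd) (merge_contracts _ _).
apply/setP => x; rewrite !merge_disjoint_verts // orbCA; do 2!congr (_ || _).
by case: (x == a) (x == b) (x == c) (x == d) => [] [] [] [].
Qed.

(** Shared by chains and twins: both orders end by fusing [a], [b], [c]. The assumed second steps
    range over all membership proofs because these are built inside the proof. *)
Lemma join_overlap G a b c (ha : a \in verts G) (hb : b \in verts G)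
    (hc : c \in verts G) :
  a != c -> b != c -> a != b ->
  (forall h h', rule_step (merge ha hb)
     (@Defs.merge V (merge ha hb) (a :|: b) c h h')) ->
  (forall h h', rule_step (merge hb hc)
     (@Defs.merge V (merge hb hc) a (b :|: c) h h')) ->
  joinable (merge ha hb) (merge hb hc).
Proof.
move=> nac nbc nab s1 s2.
have nc : c \notin [set a; b] by rewrite !inE negb_or ![c == _]eq_sym nac nbc.
have na : a \notin [set b; c] by rewrite !inE negb_or nab nac.
have hab := mem_merge_new ha hb; have hbc := mem_merge_new hb hc.
have hc' := mem_merge_other ha hb hc nc; have ha' := mem_merge_other hb hc ha na.
apply: join_step (s1 hab hc') (s2 ha' hbc) _.
apply: (contracts_verts_inj (G := G)).
- exact: contracts_trans (merge_contracts ha hb) (merge_contracts _ _).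
- exact: contracts_trans (merge_contracts hb hc) (merge_contracts _ _).
(* [merge_sym] puts [b :|: c] first, the form [merge_overlap_verts] expects. *)
apply/setP => x; rewrite (merge_sym ha') !merge_overlap_verts -setUA setUC.
congr (_ || _).
by case: (x == a) (x == b) (x == c) => [] [] [].
Qed.

(** Merging [a] and [b] absorbs the arc between them and leaves [c] as the only successor of the new
    vertex; merging [b] and [c] is dual. *)
Lemma join_chain G a b c (ha : a \in verts G) (hb : b \in verts G)
    (hc : c \in verts G) :
  sequential G a b -> sequential G b c ->
  joinable (merge ha hb) (merge hb hc).
Proof.
move=> sab sbc.
have nab : a != b by apply: (@flow_neq G); rewrite /flow sab.
have nbc : b != c by apply: (@flow_neq G); rewrite /flow sbc.
case/andP: (sab) => /eqP sa /eqP pb; case/andP: (sbc) => /eqP sb /eqP pc.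
(* If [c = a], then [a] and [b] form an isolated 2-cycle and both merges agree. *)
have [eac|nac] := eqVneq a c.
  by subst c; rewrite (bool_irrelevance hc ha) (merge_sym hb);
    exact: joinable_refl.
have nc : c \notin [set a; b] by rewrite !inE negb_or ![c == _]eq_sym nac nbc.
have na : a \notin [set b; c] by rewrite !inE negb_or nab nac.
apply: join_overlap => // h h'; apply: SequentialFlow.
- rewrite succs_mergeU sa sb; apply/setP => x; rewrite !inE.
  have [->|_] := eqVneq x c; first by move: nc; rewrite !inE => ->; rewrite orbT.
  by case: (x == a) (x == b) => [] [].
- by rewrite preds_merge // pc imset_set1 merge_map_ab ?set22.
- by rewrite succs_merge // sa imset_set1 merge_map_ab ?set21.
- rewrite preds_mergeU pb pc; apply/setP => x; rewrite !inE.
  have [->|_] := eqVneq x a; first by move: na; rewrite !inE => ->.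
  by case: (x == b) (x == c) => [] [].
Qed.

(** Without loops, twins are never adjacent: the common neighbourhoods avoid [a], [b], [c], so a
    merge leaves them unchanged. *)
Lemma join_twins G a b c (ha : a \in verts G) (hb : b \in verts G)
    (hc : c \in verts G) :
  parallel G a b -> parallel G b c ->
  joinable (merge ha hb) (merge hb hc).
Proof.
case/and3P=> nab /eqP pab /eqP sab /and3P[nbc /eqP pbc /eqP sbc].
have [eac|nac] := eqVneq a c.
  by subst c; rewrite (bool_irrelevance hc ha) (merge_sym hb);
    exact: joinable_refl.
have nc : c \notin [set a; b] by rewrite !inE negb_or ![c == _]eq_sym nac nbc.
have na : a \notin [set b; c] by rewrite !inE negb_or nab nac.
have np x : x \in [:: a; b; c] -> x \notin preds G b.
  rewrite mem_seq3 => /or3P[] /eqP ->; [rewrite -pab | | rewrite pbc];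
    exact: preds_notin.
have ns x : x \in [:: a; b; c] -> x \notin succs G b.
  rewrite mem_seq3 => /or3P[] /eqP ->; [rewrite -sab | | rewrite sbc];
    exact: succs_notin.
have D (A : {set {set V}}) x y : x \notin A -> y \notin A -> A :\: [set x; y] = A.
  move=> nx ny; apply/setDidPl; rewrite disjoint_sym disjoints_subset.
  by apply/subsetP=> z /set2P[] ->; rewrite inE.
apply: join_overlap => // h h'; apply: ParallelFlow.
- by rewrite eq_sym (merged_fresh ha hc nc).
- rewrite preds_mergeU preds_merge // pab setUid -pbc.
  by rewrite D ?imset_merge_map_id ?np ?inE ?eqxx ?orbT.
- rewrite succs_mergeU succs_merge // sab setUid -sbc.
  by rewrite D ?imset_merge_map_id ?ns ?inE ?eqxx ?orbT.
- by rewrite (merged_fresh hb ha na).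
- rewrite preds_mergeU preds_merge // -pbc setUid pab.
  by rewrite D ?imset_merge_map_id ?np ?inE ?eqxx ?orbT.
- rewrite succs_mergeU succs_merge // -sbc setUid sab.
  by rewrite D ?imset_merge_map_id ?ns ?inE ?eqxx ?orbT.
Qed.

(** If [c = a], its twin [d] is a second predecessor of [b]; if [c = b], it is a second successor of
    [a]. *)
Lemma sequential_parallel_disjoint G a b c d :
  sequential G a b -> parallel G c d -> c \notin [set a; b].
Proof.
case/andP=> /eqP sa /eqP pb /and3P[ncd /eqP pcd /eqP scd].
apply/negP => /set2P[] ec; subst c.
  have : d \in preds G b by rewrite inE; move: (set11 b); rewrite -sa scd inE.
  by rewrite pb inE eq_sym (negbTE ncd).
have : d \in succs G a by rewrite inE; move: (set11 a); rewrite -pb pcd inE.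
by rewrite sa inE eq_sym (negbTE ncd).
Qed.

Lemma join_sequential_parallel G a b c d (ha : a \in verts G)
    (hb : b \in verts G) (hc : c \in verts G) (hd : d \in verts G) :
  sequential G a b -> parallel G c d -> joinable (merge ha hb) (merge hc hd).
Proof.
move=> s p; apply: join_disjoint; rewrite /flow ?s ?p ?orbT //.
  exact: sequential_parallel_disjoint s p.
by rewrite parallel_sym in p; apply: sequential_parallel_disjoint s p.
Qed.

Lemma local_confluence G H1 H2 :
  rule_step G H1 -> rule_step G H2 -> joinable H1 H2.
Proof.
move=> /rule_stepP[a [b [ha [hb [fab ->]]]]] /rule_stepP[c [d [hc [hd [fcd ->]]]]].
have [/andP[nc nd]|] := boolP ((c \notin [set a; b]) && (d \notin [set a; b])).
  exact: join_disjoint.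
rewrite negb_and !negbK => meet.
case/orP: (fab) => [sab|pab]; case/orP: (fcd) => [scd|pcd].
- case/andP: (sab) => /eqP sa /eqP pb; case/andP: (scd) => /eqP sc /eqP pd.
  (* In order: [c = a], [c = b], [d = a], [d = b]. A shared tail or head forces the same redex; the
     mixed cases are chains. *)
  case/orP: meet => /set2P[] e; subst.
  + have ebd : b = d by apply: set1_inj; rewrite -sa -sc.
    subst d; rewrite (bool_irrelevance hc ha) (bool_irrelevance hd hb).
    exact: joinable_refl.
  + by rewrite (bool_irrelevance hc hb); apply: join_chain.
  + rewrite (bool_irrelevance hd ha); apply: joinable_sym; exact: join_chain.
  + have eac : a = c by apply: set1_inj; rewrite -pb -pd.
    subst c; rewrite (bool_irrelevance hc ha) (bool_irrelevance hd hb).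
    exact: joinable_refl.
- exact: join_sequential_parallel.
- exact/joinable_sym/join_sequential_parallel.
(* The same four cases; symmetry reorients the pairs to put the shared vertex in the middle. *)
case/orP: meet => /set2P[] e; subst.
- rewrite (bool_irrelevance hc ha) (merge_sym ha hb).
  by apply: join_twins; rewrite // parallel_sym.
- by rewrite (bool_irrelevance hc hb); apply: join_twins.
- rewrite (bool_irrelevance hd ha) (merge_sym hc) (merge_sym ha hb).
  by apply: join_twins; rewrite parallel_sym.
- rewrite (bool_irrelevance hd hb) (merge_sym hc).
  by apply: join_twins; rewrite // parallel_sym.
Qed.

(** * Termination, confluence and normal forms *)

Lemma card_rule_step G H : rule_step G H -> #|verts H| < #|verts G|.
Proof.
by case/rule_stepP=> a [b [ha [hb [/flow_neq nab ->]]]]; apply: card_merge_verts.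
Qed.

(** Passes to the closure in which [Newman] is stated. *)
Lemma reduces_toP G H : reduces_to G H <-> Rstar _ (@rule_step V) G H.
Proof.
split=> [h|]; [move: (clos_rt_rt1n _ _ _ _ h) => {h}|]; elim=> {G H} [G|G H K s _ r].
- exact: Rstar_0.
- exact: Rstar_n s r.
- exact: rt_refl.
- exact: rt_trans (rt_step _ _ _ _ s) r.
Qed.

Lemma rule_step_noetherian : Noetherian _ (@rule_step V).
Proof.
move=> G; have [n] := ubnP #|verts G|.
elim: n G => [G|n IHn G ltGn]; first by rewrite ltn0.
apply: definition_of_noetherian => H /card_rule_step ltHG.
by apply: IHn; apply: leq_trans ltHG _.
Qed.

Lemma confluence G H1 H2 :
  reduces_to G H1 -> reduces_to G H2 -> joinable H1 H2.
Proof.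
move=> /reduces_toP r1 /reduces_toP r2.
have lc : Locally_confluent _ (@rule_step V).
  move=> F F1 F2 /local_confluence j /j[K [/reduces_toP k1 /reduces_toP k2]].
  by exists K.
have [K [/reduces_toP k1 /reduces_toP k2]] :=
  Newman _ _ rule_step_noetherian lc _ _ _ r1 r2.
by exists K.
Qed.

(** Looking for a redex is a finite boolean search, so the alternative is decided constructively. *)
Lemma reducedVstep G : reduced G \/ exists H, rule_step G H.
Proof.
have [/exists_inP[a ha /exists_inP[b hb f]]|nf] :=
  boolP [exists a in verts G, exists b in verts G, flow G a b].
  by right; exists (merge ha hb); apply: flow_step.
left=> H /rule_stepP[a [b [ha [hb [f _]]]]]; case/negP: nf.
by apply/exists_inP; exists a => //; apply/exists_inP; exists b.
Qed.

Lemma exists_normal_form G : exists N, reduces_to G N /\ reduced N.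
Proof.
elim: (rule_step_noetherian G) => {}G _ IH.
have [redG|[H s]] := reducedVstep G; first by exists G; split=> //; apply: rt_refl.
have [N [r redN]] := IH H s; exists N; split=> //.
exact: rt_trans (rt_step _ _ _ _ s) r.
Qed.

Lemma reduced_reduces_to G H : reduced G -> reduces_to G H -> H = G.
Proof. by move=> redG /reduces_toP r; case: r => // K L /redG. Qed.

End Confluence.

Theorem theorem2 (V : finType) (e : rel V) (irr : irreflexive e) :
  let G := digraph_of irr in
  [/\ forall H1 H2 : mdigraph V, reduces_to G H1 -> reduces_to G H2 ->
        exists K : mdigraph V, reduces_to H1 K /\ reduces_to H2 K,
      ~ (exists f : nat -> mdigraph V,
           f 0 = G /\ forall n : nat, rule_step (f n) (f n.+1))
    & exists! N : mdigraph V, reduces_to G N /\ reduced N].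
Proof.
move=> G; split; first exact: confluence.
  case=> f [_ sf].
  have le n : #|verts (f n)| + n <= #|verts (f 0)|.
    elim: n => [|n IHn]; first by rewrite addn0.
    apply: leq_trans IHn; rewrite addnS -addSn leq_add2r.
    exact: card_rule_step.
  (* One step more than the initial number of vertices contradicts the bound. *)
  by have := leq_trans (leq_addl _ _) (le #|verts (f 0)|.+1); rewrite ltnn.
have [N [rN redN]] := exists_normal_form G; exists N; split=> // M [rM redM].
(* A common reduct of two reduced graphs equals both. *)
have [K [NK MK]] := confluence rN rM.
by rewrite -(reduced_reduces_to redN NK) (reduced_reduces_to redM MK).
Qed.
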